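(* Let $h\ge 2$ and $n\ge 1$ be integers and let $H$ be an $h$-uniform hypergraph. If $H$ is $n$-e.c., then for each vertex $v\in V(H)$, the hypergraph $H[A(v)]$ is $(n-1)$-e.c.
   Context: A hypergraph $H=(V,E)$ consists of a finite vertex set $V$ and a collection $E$ of subsets of $V$ (edges); it is $h$-uniform if every edge has exactly $h$ vertices. For a positive integer $n$, an $h$-uniform hypergraph $H$ is $n$-existentially closed ($n$-e.c.) if for every set $S\subseteq V(H)$ with $|S|=n$ and every $T\subseteq S$, there is a set $X\subseteq V(H)\setminus S$ with $|X|=h-1$ such that $X\cup\{z\}$ is an edge of $H$ for every $z\in T$ and $X\cup\{s\}$ is not an edge of $H$ for every $s\in S\setminus T$. The $h$-uniform complement $H^\mathsf{c}$ is the hypergraph on $V(H)$ whose edges are the $h$-subsets of $V(H)$ that are not edges of $H$. For $v\in V(H)$, $A(v)$ is the set of all vertices that occur together with $v$ in at least one edge of $H^\mathsf{c}$. For $Y\subseteq V(H)$, $H[Y]$ is the hypergraph with vertex set $Y$ whose edges are the edges of $H$ contained in $Y$. *)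

(* Defs.v *)
From mathcomp Require Import all_boot.
Set Implicit Arguments.
Unset Strict Implicit.
Unset Printing Implicit Defensive.

(* A hypergraph carries its own finite vertex set inside an ambient finite    *)
(* type, so that H and H[Y] live over the same type.                          *)
Record hypergraph (vT : finType) := Hypergraph {
  vertices : {set vT};
  edges : {set {set vT}};
  edges_sub : edges \subset powerset vertices
}.

Definition uniform (vT : finType) (h : nat) (H : hypergraph vT) : Prop :=
  forall e : {set vT}, e \in edges H -> #|e| = h.

(* Meant for h-uniform H. The same formula is used for n = 0, where it asks   *)
(* for a set of h - 1 vertices.                                               *)
Definition n_ec (vT : finType) (h n : nat) (H : hypergraph vT) : Prop :=
  forall S : {set vT}, S \subset vertices H -> #|S| = n ->
  forall T : {set vT}, T \subset S ->
  exists X : {set vT},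
    [/\ X \subset vertices H :\: S,
        #|X| = h - 1,
        forall z : vT, z \in T -> X :|: [set z] \in edges H
      & forall s : vT, s \in S :\: T -> X :|: [set s] \notin edges H].

Definition compl_edges (vT : finType) (h : nat) (H : hypergraph vT) :
    {set {set vT}} :=
  [set e in powerset (vertices H) | (#|e| == h) && (e \notin edges H)].

Lemma compl_edges_sub (vT : finType) (h : nat) (H : hypergraph vT) :
  compl_edges h H \subset powerset (vertices H).
Proof. by apply/subsetP => e; rewrite inE => /andP[]. Qed.

Definition ucompl (vT : finType) (h : nat) (H : hypergraph vT) :
    hypergraph vT :=
  Hypergraph (compl_edges_sub h H).

(* "Occurring together with v" concerns vertices other than v: v itself is    *)
(* not a member of A(v).                                                      *)
Definition A_set (vT : finType) (h : nat) (H : hypergraph vT) (v : vT) :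
    {set vT} :=
  [set u | (u != v) &&
           [exists e in edges (ucompl h H), (u \in e) && (v \in e)]].

Definition induced_edges (vT : finType) (H : hypergraph vT) (Y : {set vT}) :
    {set {set vT}} :=
  [set e in edges H | e \subset Y].

Lemma induced_edges_sub (vT : finType) (H : hypergraph vT) (Y : {set vT}) :
  induced_edges H Y \subset powerset Y.
Proof. by apply/subsetP => e; rewrite !inE => /andP[]. Qed.

Definition induced (vT : finType) (H : hypergraph vT) (Y : {set vT}) :
    hypergraph vT :=
  Hypergraph (induced_edges_sub H Y).

Lemma uniform_induced (vT : finType) (h : nat) (H : hypergraph vT)
    (Y : {set vT}) :
  uniform h H -> uniform h (induced H Y).
Proof. by move=> uH e; rewrite inE => /andP[/uH]. Qed.

Lemma A_set_sub (vT : finType) (h : nat) (H : hypergraph vT) (v : vT) :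
  A_set h H v \subset vertices H.
Proof.
apply/subsetP => u; rewrite inE => /andP[_ /exists_inP[e]].
rewrite 2!inE => /andP[/subsetP sub _] /andP[ue _]; exact: sub.
Qed.

(* Main.v *)
Require Import Defs.
From mathcomp Require Import all_boot.

(* Apply n-existential closure to S together with v, leaving v out of T. The  *)
(* resulting X makes X + v a non-edge, i.e. an edge of the complement, and    *)
(* this is what puts all of X inside A(v).                                    *)

Lemma nonedge_sub_A_set (vT : finType) (h : nat) (H : hypergraph vT)
    (v : vT) (X : {set vT}) :
  0 < h -> v \in vertices H -> X \subset vertices H -> v \notin X ->
  #|X| = h - 1 -> X :|: [set v] \notin edges H -> X \subset A_set h H v.
Proof.
move=> h_gt0 vH sXH vX cardX XvH; apply/subsetP => u uX.
rewrite inE; apply/andP; split; first by apply: contraNneq vX => <-.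
(* One complement edge serves every [u]; its size is [1 + (h - 1)], which is [h] as [0 < h]. *)
apply/exists_inP; exists (X :|: [set v]); last by rewrite !inE uX eqxx orbT.
by rewrite !inE subUset sXH sub1set vH XvH setUC cardsU1 vX cardX subnKC ?eqxx.
Qed.

Theorem theorem6 (vT : finType) (h n : nat) (H : hypergraph vT) :
  2 <= h -> 1 <= n ->
  uniform h H ->
  n_ec h n H ->
  forall v : vT, v \in vertices H ->
    n_ec h (n - 1) (induced H (A_set h H v)).
Proof.
move=> h_ge2 n_gt0 _ ecH v vH S /= sSA cardS T sTS.
(* As [A_set] leaves out [v], adding [v] to [S] gives exactly [n] vertices. *)
have vS : v \notin S by apply/negP => /(subsetP sSA); rewrite inE eqxx.
have sSvH : v |: S \subset vertices H.
  by rewrite subUset sub1set vH (subset_trans sSA (A_set_sub h H v)).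
have cardSv : #|v |: S| = n by rewrite cardsU1 vS cardS subnKC.
have sTSv : T \subset v |: S by rewrite (subset_trans sTS) ?subsetUr.
have [X [sX cardX XT XST]] := ecH _ sSvH cardSv T sTSv.
move: sX; rewrite setDUr subsetI subsetD1 => /andP[/andP[sXH vX]].
rewrite subsetD sXH /= => dXS.
have sXA : X \subset A_set h H v.
  apply: nonedge_sub_A_set => //; first exact: ltnW.
  (* [v] lies outside [T], since [T] is inside [S]. *)
  by apply: XST; rewrite !inE eqxx andbT; apply: contra vS; apply/subsetP.
(* The same [X] works: each [X :|: [set z]] with [z] in [T] stays inside A(v), so it remains an
   edge, and restricting to A(v) creates no new edges. *)
exists X; split=> // [|z zT|s].
- by rewrite subsetD sXA.
- rewrite inE XT //= subUset sXA sub1set.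
  exact: (subsetP sSA) (subsetP sTS _ zT).
- rewrite inE => /andP[sT sS].
  by rewrite inE negb_and XST // !inE sT sS orbT.
Qed.
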